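(* Let $q$ be a power of an odd prime, let $\lambda\in\mathbb{F}_q$ be a non-square, and let $f\in\mathbb{F}_q[X]$ be a polynomial of degree one with non-zero constant term. Then every directed path of Type 1 in $\mathcal{G}(\lambda,f)$ contains at most $\lfloor \frac{3}{4}q+\frac{17}{4}\rfloor$ vertices.
   Context: For a polynomial $f\in\mathbb{F}_q[X]$ and a non-square $\lambda\in\mathbb{F}_q$, $\mathcal{G}(\lambda,f)$ is the directed graph with vertex set $\mathbb{F}_q$ and an edge from $x$ to $y$ iff $(y^2-f(x))(\lambda y^2-f(x))=0$ (loops allowed). Paths have distinct vertices. Weights: an edge $(x,y)$ has weight $0$ if $y^2=f(x)$ and weight $1$ otherwise (so the edge into vertex $0$ has weight $0$). A trail is a directed path all of whose edges have the same weight; its length is its number of edges. A directed path is of Type $n$ if it contains a trail of length $n$ but no trail of length greater than $n$. *)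

(* Defs.v *)
From HB Require Import structures.
From mathcomp Require Import all_boot all_order all_algebra all_field.

Set Implicit Arguments.
Unset Strict Implicit.
Unset Printing Implicit Defensive.

Import Order.TTheory GRing.Theory Num.Theory.

Local Open Scope ring_scope.

Definition is_square (F : finFieldType) (a : F) : bool :=
  [exists x : F, a == x ^+ 2].

Section Graph.

Variables (F : finFieldType) (lambda : F) (f : {poly F}).

Definition edge : rel F :=
  fun x y => (y ^+ 2 - f.[x]) * (lambda * y ^+ 2 - f.[x]) == 0.

(* Only meaningful on pairs (x, y) such that edge x y holds. *)
Definition weight (x y : F) : nat := if y ^+ 2 == f.[x] then 0 else 1.

(* A directed path is given by the sequence of its vertices, which is nonempty;
   a single vertex is a path of length 0. *)
Definition dipath (s : seq F) : bool :=
  [&& s != [::], uniq s & sorted edge s].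

Definition path_length (s : seq F) : nat := (size s).-1.

Definition edge_weights (s : seq F) : seq nat :=
  if s is x :: s' then pairmap weight x s' else [::].

Definition trail (s : seq F) : bool :=
  dipath s && constant (edge_weights s).

(* The vertices of a path being distinct, the directed paths contained in it
   are its nonempty contiguous subsequences. *)
Definition path_of_type (n : nat) (s : seq F) : Prop :=
  [/\ dipath s,
      exists t, [/\ infix t s, trail t & path_length t = n]
    & forall t, infix t s -> trail t -> (path_length t <= n)%N].

End Graph.

(* Main.v *)
(** Edges out of [x] have weight 0 exactly when [f x] is a square, and the two
    vertices [y], [-y] have the same in-neighbours, one for each weight. Along a
    path of Type 1 the weights alternate; so if [y <> 0] and [-y] are both
    interior vertices, they are entered, hence also left, with different
    weights, and [f y * f (-y)] is not a non-zero square. Writing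
    [f = aX + b], the points [z^2 + (ay)^2 = b^2] of a conic, parametrized
    rationally, give at least [(q - 5) / 2] non-zero [y] for which
    [f y * f (-y)] is a non-zero square, and the interior of the path misses
    one vertex of each such pair [{y, -y}]. *)
Require Import Defs.
From HB Require Import structures.
From mathcomp Require Import all_boot all_order all_algebra all_field.
From mathcomp Require Import zify ring lra.

Set Implicit Arguments.
Unset Strict Implicit.
Unset Printing Implicit Defensive.

Import Order.TTheory GRing.Theory Num.Theory.

Local Open Scope ring_scope.

Lemma is_squareP (F : finFieldType) (a : F) :
  reflect (exists x, a = x ^+ 2) (is_square a).
Proof. by apply: (iffP existsP) => -[x]; [move/eqP|move->]; exists x. Qed.

Lemma is_square_divr (F : finFieldType) (a b : F) :
  a * b != 0 -> is_square (a * b) -> is_square a -> is_square b.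
Proof.
rewrite mulf_eq0 negb_or => /andP[a0 _] /is_squareP[z abz] /is_squareP[x ax].
have x0 : x != 0 by apply: contraNneq a0 => x0; rewrite ax x0 expr0n.
apply/is_squareP; exists (z / x).
by rewrite expr_div_n -abz -ax mulrAC mulfV ?mul1r.
Qed.

Lemma eq_is_square_mul (F : finFieldType) (a b : F) :
  a * b != 0 -> is_square (a * b) -> is_square a = is_square b.
Proof.
move=> ab0 sqab; apply/idP/idP; first exact: is_square_divr.
by apply: is_square_divr; rewrite mulrC.
Qed.

Lemma horner_size2 (R : comNzRingType) (f : {poly R}) (x : R) :
  size f = 2%N -> f.[x] = f`_1 * x + f`_0.
Proof.
move=> f2; rewrite horner_coef f2 big_ord_recl big_ord1 /= expr0 expr1 mulr1.
by rewrite addrC.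
Qed.

Lemma size2_coef1_neq0 (R : nzRingType) (f : {poly R}) :
  size f = 2%N -> f`_1 != 0.
Proof.
move=> f2; have -> : 1%N = (size f).-1 by rewrite f2.
by rewrite -/(lead_coef f) lead_coef_eq0 -size_poly_eq0 f2.
Qed.

Section Weights.

Variables (F : finFieldType) (lambda : F) (f : {poly F}).

(** The weight and [y ^+ 2] determine [f.[x]]. So for injective [f] each weight allows at most one
    in-neighbour, and it is the same for [y] and [- y]. *)
Lemma edge_horner (x y : F) : edge lambda f x y ->
  f.[x] = (if weight f x y == 0%N then 1 else lambda) * y ^+ 2.
Proof.
rewrite /edge /weight; case: (eqVneq (y ^+ 2)) => [->|ne] /=.
  by rewrite mul1r.
by rewrite mulf_eq0 !subr_eq0 (negPf ne) /= => /eqP <-.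
Qed.

Lemma weight_eq0 (x y : F) : ~~ is_square lambda -> edge lambda f x y ->
  (weight f x y == 0%N) = is_square f.[x].
Proof.
move=> nsq /edge_horner; case: (eqVneq (weight f x y) 0%N) => [_|w0] fx.
  by apply/esym/idP/is_squareP; exists y; rewrite fx mul1r.
apply/esym/negbTE/negP => /is_squareP[z fz].
(* An edge into 0 has weight 0. With [y] invertible, a square value [lambda * y ^+ 2] would make
   [lambda] a square. *)
have y0 : y != 0.
  apply: contraNneq w0 => y0.
  by rewrite /weight fx y0 expr0n /= mulr0 eqxx.
case/negP: nsq; apply/is_squareP; exists (z / y).
by rewrite expr_div_n -fz fx mulfK ?expf_neq0.
Qed.

Lemma type1_weight_alternates (s : seq F) (i : nat) : path_of_type lambda f 1 s ->
  (i.+2 < size s)%N ->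
  (weight f s`_i.+1 s`_i.+2 == 0%N) = (weight f s`_i s`_i.+1 != 0%N).
Proof.
case=> /and3P[_ us es] _ len_le lt_is.
suff : weight f s`_i s`_i.+1 != weight f s`_i.+1 s`_i.+2.
  by rewrite /weight; case: ifP; case: ifP.
apply/negP => /eqP eqw.
(* Equal consecutive weights turn these three vertices into a trail of length 2, which Type 1
   forbids. *)
pose t := take 3 (drop i s).
have inf : infix t s.
  rewrite -[s](cat_take_drop i) -[drop i s](cat_take_drop 3) /t.
  by rewrite infix_infix.
have td : t = [:: s`_i; s`_i.+1; s`_i.+2].
  by rewrite /t (drop_nth 0) 1?(drop_nth 0) 1?(drop_nth 0) /= ?take0 //; lia.
have edge_s (j : nat) : (j.+1 < size s)%N -> edge lambda f s`_j s`_j.+1.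
  exact/sortedP.
have := len_le t inf; rewrite /trail /dipath (infix_uniq inf us) td /=.
by rewrite !edge_s ?(ltnW lt_is) //= eqw eqxx => /(_ isT).
Qed.

End Weights.

(** For such [y], [f.[y]] and [f.[- y]] are both squares or both non-squares, so edges leaving [y]
    and [- y] have the same weight. *)
Definition square_pairs (F : finFieldType) (f : {poly F}) : {set F} :=
  [set y | [&& y != 0, f.[y] * f.[- y] != 0 & is_square (f.[y] * f.[- y])]].

Lemma square_pairsN (F : finFieldType) (f : {poly F}) (y : F) :
  (- y \in square_pairs f) = (y \in square_pairs f).
Proof. by rewrite !inE opprK oppr_eq0 mulrC. Qed.

(** The product is [t - t^5], with at most five roots. These are the parameters to discard in the
    rational parametrization of the conic. *)
Lemma card_nonroots_X5BX (F : finFieldType) :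
  (#|F| - 5 <= #|[set t : F | (t * (1 - t ^+ 2) * (1 + t ^+ 2) != 0)%R]|)%N.
Proof.
set T := [set t | _].
have size_p : size ('X^5 - 'X : {poly F}) = 6%N.
  by rewrite size_polyDl size_polyXn // size_polyN size_polyX.
have p0 : 'X^5 - 'X != 0 :> {poly F} by rewrite -size_poly_eq0 size_p.
rewrite -(cardsC T) leq_subLR addnC leq_add2r -ltnS.
rewrite cardE -size_p; apply: max_poly_roots => //; last exact: enum_uniq.
apply/allP => t; rewrite mem_enum !inE negbK => /eqP t0.
rewrite rootE !hornerE /=; apply/eqP.
by transitivity (- (t * (1 - t ^+ 2) * (1 + t ^+ 2))); [ring|rewrite t0 oppr0].
Qed.

Lemma card_square_pairs (F : finFieldType) (f : {poly F}) :
  (2 : F) != 0 -> size f = 2%N -> f`_0 != 0 ->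
  (#|F| - 5 <= 2 * #|square_pairs f|)%N.
Proof.
move=> two0 f2 b0; apply: leq_trans (card_nonroots_X5BX F) _.
set T := [set t | _].
have a0 := size2_coef1_neq0 f2.
set a := f`_1 in a0; set b := f`_0 in b0.
(* The [y]-coordinate of the parametrized conic; the other coordinate is
   [z = b(1 - t^2) / (1 + t^2)], whose square is [f.[y] * f.[- y]]. *)
pose phi t := 2 * b * t / (a * (1 + t ^+ 2)).
have memT t : t \in T -> [/\ t != 0, 1 - t ^+ 2 != 0 & 1 + t ^+ 2 != 0].
  by rewrite inE !mulf_eq0 !negb_or => /andP[/andP[]].
have phiT t : t \in T -> phi t \in square_pairs f.
  move=> /memT[t0 t1 t2].
  have ffE : f.[phi t] * f.[- phi t] =
      (b * (1 - t ^+ 2) / (1 + t ^+ 2)) ^+ 2.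
    by rewrite !horner_size2 // -/a -/b /phi; field; rewrite t2.
  rewrite inE ffE; apply/and3P; split.
  - by rewrite !(mulf_eq0, invr_eq0, negb_or) two0 b0 t0 a0.
  - by rewrite expf_neq0 // !(mulf_eq0, invr_eq0, negb_or) b0 t1.
  - by apply/is_squareP; eexists.
(* Count [T] along the fibres of [phi]: each lies in some [{u, u^-1}]. *)
rewrite -sum1_card (partition_big phi _ phiT) /= mulnC -sum_nat_const.
apply: leq_sum => y _; rewrite sum1_card.
case: (pickP [pred t | (t \in T) && (phi t == y)]) => [u|no]; last first.
  by rewrite (eq_card0 no).
move=> /andP[uT /eqP phiu].
apply: leq_trans (_ : #|[set u; u^-1]| <= 2)%N; last by rewrite cards2; case: eqP.
apply: subset_leq_card; apply/subsetP => t; rewrite in_set2 => /andP[tT].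
rewrite -phiu => /eqP phitu.
have [u0 _ u2] := memT _ uT.
have [t0 _ t2] := memT _ tT.
(* Clearing denominators in [phi t = phi u] leaves [t(1 + u^2) - u(1 + t^2)], which factors this
   way. *)
have : (t - u) * (1 - t * u) = 0.
  transitivity ((phi t - phi u) * (a * (1 + t ^+ 2) * (1 + u ^+ 2)) / (2 * b)).
    by rewrite /phi; field; rewrite b0 two0 a0 t2 u2.
  by rewrite phitu subrr !mul0r.
move/eqP; rewrite mulf_eq0 !subr_eq0 => /orP[->//|/eqP tu1].
by apply/orP; right; rewrite -[t](mulfK u0) -tu1 mul1r.
Qed.

Definition interior (T : Type) (s : seq T) : seq T := behead (take (size s).-1 s).

Lemma size_interior (T : Type) (s : seq T) : size (interior s) = (size s - 2)%N.
Proof. by rewrite size_behead size_take; case: ltnP => ?; lia. Qed.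

(** Indexing by [i.+1] gives the predecessor [i] and the successor [i.+2] without subtraction. *)
Lemma mem_interior (T : eqType) (x0 : T) (s : seq T) (x : T) :
  x \in interior s -> exists2 i, (i.+2 < size s)%N & x = nth x0 s i.+1.
Proof.
move=> /(nthP x0)[i]; rewrite size_interior => lt_i <-; exists i; first by lia.
by rewrite nth_behead nth_take //; lia.
Qed.

Lemma interior_uniq (T : eqType) (s : seq T) : uniq s -> uniq (interior s).
Proof.
move=> us; rewrite /interior -drop1.
by apply: drop_uniq; apply: take_uniq.
Qed.

Lemma interior_opp_notin (F : finFieldType) (lambda : F) (f : {poly F})
    (s : seq F) (y : F) :
  (2 : F) != 0 -> ~~ is_square lambda -> size f = 2%N ->
  path_of_type lambda f 1 s -> y \in square_pairs f ->
  y \in interior s -> - y \notin interior s.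
Proof.
move=> two0 nsq f2 s1 yG /(mem_interior 0)[i lt_i yE].
apply/negP => /(mem_interior 0)[j lt_j yNE].
have [/and3P[_ us es] _ _] := s1.
have edge_s (l : nat) : (l.+1 < size s)%N -> edge lambda f s`_l s`_l.+1.
  exact/sortedP.
move: yG; rewrite inE => /and3P[y0 ff0 sqff].
have eq_out : (weight f s`_i.+1 s`_i.+2 == 0%N) = (weight f s`_j.+1 s`_j.+2 == 0%N).
  rewrite !(weight_eq0 nsq (edge_s _ _)) // -yE -yNE.
  exact: eq_is_square_mul.
have eq_in : (weight f s`_i s`_i.+1 == 0%N) = (weight f s`_j s`_j.+1 == 0%N).
  by apply: negb_inj; rewrite -!(type1_weight_alternates s1).
(* Equal incoming weights and equal squares of the heads give the predecessors the same value under
   the injective [f]. They coincide, so [j = i] and [y = - y]. *)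
have := edge_horner (edge_s j (ltnW lt_j)).
rewrite -eq_in -yNE sqrrN yE -(edge_horner (edge_s i (ltnW lt_i))).
rewrite !horner_size2 // => /addIr /mulfI eq_s.
have a0 := size2_coef1_neq0 f2.
have /eqP := eq_s a0.
rewrite (nth_uniq _ (ltnW (ltnW lt_j)) (ltnW (ltnW lt_i)) us) => /eqP eqji.
have : y *+ 2 = 0.
  by rewrite mulr2n {1}yE -eqji -yNE addNr.
by rewrite -mulr_natl => /eqP; rewrite mulf_eq0 (negPf two0) (negPf y0).
Qed.

Lemma size_type1_path (F : finFieldType) (lambda : F) (f : {poly F})
    (s : seq F) :
  (2 : F) != 0 -> ~~ is_square lambda -> size f = 2%N -> f`_0 != 0 ->
  path_of_type lambda f 1 s -> (4 * size s <= 3 * #|F| + 13)%N.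
Proof.
move=> two0 nsq f2 b0 s1; have [/and3P[_ us _] _ _] := s1.
pose I := [set y in interior s]; pose G := square_pairs f.
have cardI : #|I| = (size s - 2)%N.
  by rewrite cardsE (card_uniqP (interior_uniq us)) size_interior.
have disj : [disjoint I :&: G & -%R @: (I :&: G)].
  rewrite disjoint_subset; apply/subsetP => y /setIP[yI _].
  rewrite inE; apply/negP => /imsetP[z /setIP[zI zG] yE].
  move: yI zI; rewrite yE !inE => zNI zI.
  by move: zNI; rewrite (negPf (interior_opp_notin two0 nsq f2 s1 zG zI)).
have half : (2 * #|I :&: G| <= #|G|)%N.
  rewrite mul2n -addnn -{2}(card_imset _ (@oppr_inj F)).
  have [_] := leq_card_setU (I :&: G) (-%R @: (I :&: G)).
  rewrite disj => /eqP <-.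
  apply: subset_leq_card; rewrite subUset subsetIr.
  by apply/subsetP => _ /imsetP[y /setIP[_ yG] ->]; rewrite square_pairsN.
have leF : (#|I :|: G| <= #|F|)%N := max_card _.
(* Inclusion-exclusion bounds [#|I|] by [q - #|G| / 2], hence by [q - (q - 5) / 4]; the two
   endpoints then give [(3q + 13) / 4]. *)
have := cardsUI I G; rewrite cardI.
move: #|F| (card_square_pairs two0 f2 b0) leF half => q.
by move: #|I :|: G| #|I :&: G| #|G|; lia.
Qed.

Theorem theorem2p9 (F : finFieldType) (p k q : nat)
    (p_prime : prime p) (p_odd : odd p) (k_gt0 : (0 < k)%N)
    (q_def : q = (p ^ k)%N) (cardF : #|F| = q)
    (lambda : F) (lambda_nonsquare : ~~ is_square lambda)
    (f : {poly F}) (f_degree1 : size f = 2%N) (f_const : f`_0 != 0)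
    (s : seq F) (s_type1 : path_of_type lambda f 1 s) :
  (size s)%:Z <= Num.floor (3 / 4 * q%:R + 17 / 4 : rat).
Proof.
have charF : p \in [pchar F].
  by apply: (@card_finPcharP _ _ k) => //; rewrite cardF.
have two0 : (2 : F) != 0.
  rewrite -(dvdn_pcharf charF) dvdn_prime2 //.
  by apply: contraTneq p_odd => ->.
have := size_type1_path two0 lambda_nonsquare f_degree1 f_const s_type1.
rewrite cardF -(ler_nat rat) natrD !natrM => size_s.
(* The bound [(3q + 13) / 4] is smaller by 1 than the required one. *)
rewrite floor_ge_int ?num_real // -pmulrn; lra.
Qed.
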